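(* Let $G$ be a finite (additive) abelian group with $n=|G|\ge 3$, let $\Gamma=\mathrm{Cay}(G,S)$ be a connected simple Cayley graph, and let $d=|S|$. Let $g,h\in G$ with $a=g-h\ne 0$. Let $G_0=\{x\in G:\chi_a(x)=1\}$, $G_1=\{x\in G:\chi_a(x)=-1\}$. Then $\Gamma$ has PST between $g$ and $h$ (at some time $t>0$) if and only if the following three conditions hold: (I) $\Gamma$ is an integral graph, i.e. $\alpha_x=\sum_{s\in S}\chi_x(s)\in\mathbb{Z}$ for all $x\in G$; (II) the order of $a$ is two; (III) the numbers $v_2(d-\alpha_x)$ for $x\in G_1$ are all equal to the same number, say $\rho$, and $v_2(M_0)\ge\rho+1$, where $M_0=\gcd(d-\alpha_x : x\in G_0)$. Moreover, if conditions (I)–(III) are satisfied, then the set $T(g,h)=\{t>0 : \Gamma \text{ has PST between } g \text{ and } h \text{ at time } t\}$ equals $\left\{\frac{\pi}{M}+\frac{2\pi}{M}\ell : \ell=0,1,2,\dots\right\}$, where $M=\gcd(d-\alpha_x : 0\ne x\in G)$.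
   Context: For a finite additive abelian group $G$ and a nonempty subset $S\subseteq G$, the Cayley graph $\mathrm{Cay}(G,S)$ has vertex set $G$, with $u,v$ adjacent iff $u-v\in S$. It is simple when $0\notin S$ and $-S=S$, and connected when $S$ generates $G$. Let $A$ be its adjacency matrix and $H(t)=\exp(itA)=(H_{u,v}(t))_{u,v\in G}$ for $t\in\mathbb{R}$, $i=\sqrt{-1}$. $\Gamma$ has perfect state transfer (PST) between $u$ and $v$ at time $t>0$ if $|H_{u,v}(t)|=1$. Fix a decomposition $G=\mathbb{Z}_{n_1}\oplus\cdots\oplus\mathbb{Z}_{n_r}$. For $x=(x_1,\dots,x_r)\in G$, $\chi_x$ is the character $\chi_x(g)=\prod_{s=1}^r \exp(2\pi i x_sg_s/n_s)$ of $G$, and $x\mapsto\chi_x$ is an isomorphism from $G$ to its character group. The eigenvalues of $A$ are the real numbers $\alpha_x=\sum_{s\in S}\chi_x(s)$, $x\in G$. $v_2:\mathbb{Q}\to\mathbb{Z}\cup\{\infty\}$ is the 2-adic exponential valuation: $v_2(0)=\infty$ and $v_2(2^\ell b/c)=\ell$ for $b,c$ odd integers. *)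

(* Defs.v *)
From HB Require Import structures.
From mathcomp Require Import all_boot all_order all_fingroup all_algebra.
From mathcomp Require Import complex.
From mathcomp Require Import all_classical all_reals all_analysis.

Set Implicit Arguments.
Unset Strict Implicit.
Unset Printing Implicit Defensive.

Import Order.TTheory GRing.Theory Num.Theory.
Import numFieldNormedType.Exports.

Local Open Scope ring_scope.
Local Open Scope complex_scope.

(* The sum of the power series \sum_k M ^+ k / k! in the normed space of
   n x n matrices; M ^+ 0 is the identity matrix. *)
Definition expmx (K : numFieldType) (n : nat) (M : 'M[K]_n) : 'M[K]_n :=
  limn (series (fun k : nat => (k`!%:R)^-1 *: M ^+ k)).

(* exp(i theta), for a real angle theta *)
Definition expi (R : realType) (theta : R) : R[i] := cos theta +i* sin theta.

Section Graphs.
Variable V : finType.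

(* Matrices are indexed by ordinals, so vertices are numbered by enum_rank. *)
Definition adjmx (K : numFieldType) (e : rel V) : 'M[K]_#|V| :=
  \matrix_(i, j) (e (enum_val i) (enum_val j))%:R.

Definition transition (R : realType) (e : rel V) (t : R) (u v : V) : R[i] :=
  expmx ((0 +i* t) *: adjmx R[i] e) (enum_rank u) (enum_rank v).

Definition pst (R : realType) (e : rel V) (u v : V) (t : R) : Prop :=
  0 < t /\ `|transition e t u v : (R[i] : numFieldType)| = 1.

Definition pst_times (R : realType) (e : rel V) (u v : V) : set R :=
  [set t : R | pst e u v t]%classic.

End Graphs.

Section Cayley.
Variables (G : finZmodType) (S : {set G}).

Definition cayley : rel G := fun u v => u - v \in S.

Definition cayley_simple : Prop := 0 \notin S /\ [set - s | s in S] = S.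

(* <<S>> is the subgroup of (G, +) generated by S. *)
Definition cayley_connected : Prop := <<S>>%g = [set: G].

End Cayley.

(* An identification of G with Z_{n_1} (+) ... (+) Z_{n_r}: the s-th coordinate
   is a morphism onto Z_{n_s}, where n_s = (dec_m s).+1, so that 'I_n_s carries
   its group structure of integers modulo n_s (the trivial one if n_s = 1). *)
Record cyclic_decomposition (G : finZmodType) := CyclicDecomposition {
  dec_r : nat;
  dec_m : 'I_dec_r -> nat;
  dec_coord : forall s : 'I_dec_r, {additive G -> 'I_(dec_m s).+1};
  dec_bij : bijective
    (fun x : G => [ffun s => dec_coord s x] : {dffun forall s, 'I_(dec_m s).+1})
}.

(* The 2-adic valuation, with values in Z extended by infinity. *)
Definition v2 (q : rat) : \bar int :=
  if q == 0 then +oo%E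
  else ((logn 2 `|numq q|%N)%:Z - (logn 2 `|denq q|%N)%:Z)%:E.

Section Spectrum.
Variables (R : realType) (G : finZmodType) (D : cyclic_decomposition G).

Definition chi (x g : G) : R[i] :=
  \prod_(s < dec_r D)
    expi (2 * pi * (dec_coord s x)%:R * (dec_coord s g)%:R
          / (dec_m s).+1%:R).

Variable S : {set G}.

Definition alpha (x : G) : R[i] := \sum_(s in S) chi x s.

Definition integral_cayley : Prop :=
  forall x : G, exists k : int, alpha x = k%:~R.

(* alpha x as an integer; only meaningful under integral_cayley, where
   alpha x = (alphaZ x)%:~R. *)
Definition alphaZ (x : G) : int := Num.floor (complex.Re (alpha x)).

Definition dmalpha (x : G) : int := #|S|%:Z - alphaZ x.

(* gcd(d - alpha_x : x \in X) *)
Definition gcd_dmalpha (X : {set G}) : int :=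
  \big[gcdz/0]_(x in X) dmalpha x.

Definition G0 (a : G) : {set G} := [set x | chi a x == 1].
Definition G1 (a : G) : {set G} := [set x | chi a x == -1].

Definition M0 (a : G) : int := gcd_dmalpha (G0 a).
Definition Mall : int := gcd_dmalpha [set x | x != 0].

Definition valuation_condition (a : G) : Prop :=
  exists rho : int,
    (forall x : G, x \in G1 a -> v2 (dmalpha x)%:Q = rho%:E) /\
    ((rho + 1)%:E <= v2 (M0 a)%:Q)%E.

End Spectrum.

(* Main.v *)
Require Import Defs.
From HB Require Import structures.
From mathcomp Require Import all_boot all_order all_fingroup all_algebra.
From mathcomp Require Import complex.
From mathcomp Require Import all_classical all_reals all_analysis.
From mathcomp Require Import cyclic algC algnum archimedean.
From mathcomp Require Import zify ring lra.

Set Implicit Arguments.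
Unset Strict Implicit.
Unset Printing Implicit Defensive.

Import Order.TTheory GRing.Theory Num.Theory.
Import numFieldNormedType.Exports.

Local Open Scope ring_scope.
Local Open Scope complex_scope.

(* The characters diagonalise the adjacency matrix of a Cayley graph, so the (u, v)
   entry of exp(itA) is the average over x of exp(i t alpha_x) chi_x(u - v). It has
   modulus 1 iff all these unit complex numbers agree with the one at x = 0, i.e. iff
   exp(i t (d - alpha_x)) = chi_x(a) for all x, where a = u - v.

   As alpha_{-x} = alpha_x, this forces chi_x(2a) = 1 for all x, so a has order two,
   every chi_x(a) is 1 or -1, and t (d - alpha_x) = pi k_x for integers k_x that are
   odd exactly on G_1. Summing over x and using sum_x alpha_x = 0 gives
   t d n = pi sum_x k_x, so every alpha_x is rational; being an eigenvalue of an
   integer matrix, it is an integer. Cross-multiplying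
   (d - alpha_x) k_y = (d - alpha_y) k_x with y in G_1 gives the 2-adic condition.
   Conversely, that condition says that (d - alpha_x) / M is odd exactly on G_1, and
   the k_x exist iff t = pi K / M with K odd. *)

(** * The unit circle: the map [expi] and its kernel *)

Section ExpI.
Variable R : realType.
Implicit Types (x y : R) (k : int).

Lemma expi0 : expi (0 : R) = 1.
Proof. by rewrite /expi cos0 sin0. Qed.

Lemma expiD x y : expi (x + y) = expi x * expi y.
Proof. by rewrite /expi cosD sinD; simpc; rewrite [sin x * _ + _]addrC. Qed.

Lemma expiN x : expi (- x) = (expi x)^*.
Proof. by rewrite /expi cosN sinN. Qed.

Lemma norm_expi x : `|expi x| = 1.
Proof. by rewrite normc_def /= cos2Dsin2 sqrtr1. Qed.

Lemma conj_expi x : (expi x)^* = (expi x)^-1.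
Proof. by rewrite invc_norm norm_expi expr1n invr1 mul1r. Qed.

Lemma expi_neq0 x : expi x != 0.
Proof. by rewrite -normr_eq0 norm_expi oner_eq0. Qed.

Lemma expi_pi : expi (pi : R) = -1.
Proof. by rewrite /expi cospi sinpi; apply/eqP; rewrite eq_complex /= oppr0 !eqxx. Qed.

Lemma expiMn x n : expi (x *+ n) = expi x ^+ n.
Proof. by elim: n => [|n IHn]; rewrite ?expi0 // mulrS expiD exprS IHn. Qed.

Lemma expi_pi_int k : expi (pi * k%:~R : R) = (-1) ^+ `|k|%N.
Proof.
case: k => n; rewrite ?NegzE ?abszN absz_nat.
  by rewrite -pmulrn mulr_natr expiMn expi_pi.
by rewrite mulrNz mulrN expiN -pmulrn mulr_natr expiMn expi_pi rmorphXn rmorphN1.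
Qed.

Lemma expi_2pi_int k : expi (2 * pi * k%:~R : R) = 1.
Proof.
have -> : 2 * pi * k%:~R = pi * (2 * k)%:~R :> R by rewrite intrM; ring.
by rewrite expi_pi_int abszM exprM expr2 mulrNN mulr1 expr1n.
Qed.

(** Subtracting whole turns, counted by a floor, moves the angle into [[0, 2 pi)]. On [[0, pi]] the
    cosine is injective, so only [0] has cosine 1. *)
Lemma expi_eq1 x : expi x = 1 -> exists k, x = 2 * pi * k%:~R.
Proof.
have pi2 : 0 < 2 * pi :> R by rewrite mulr_gt0 ?pi_gt0.
pose k := Num.floor (x / (2 * pi)); pose y := x - 2 * pi * k%:~R => ex.
have : expi y = 1.
  by rewrite expiD ex mul1r expiN expi_2pi_int rmorph1.
have : 0 <= y < 2 * pi.
  have -> : y = 2 * pi * (x / (2 * pi) - k%:~R).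
    by rewrite mulrBr mulrC divfK ?gt_eqF.
  have /andP[kle ltk] := floor_itv (x / (2 * pi)).
  rewrite mulr_ge0 ?subr_ge0 ?(ltW pi2) //= gtr_pMr // ltrBlDl.
  by rewrite intrD in ltk.
case/andP=> y0 yl [cy sy]; exists k; suff: y = 0 by move/subr0_eq.
have cos_eq1 z : 0 <= z <= pi -> cos z = 1 -> z = 0 :> R.
  move=> zpi cz; apply: cos_inj; rewrite ?cz ?cos0 //.
  by rewrite in_itv /= lexx pi_ge0.
have [ypi|ypi] := leP y pi; first by apply: cos_eq1; rewrite ?y0.
(* An angle beyond [pi] is reflected to [2 pi - y], which lies in [[0, pi]]; its vanishing
   contradicts [y < 2 pi]. *)
have : 2 * pi - y = 0; last lra.
  apply: cos_eq1; first lra.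
  by rewrite cosB sy mulr0 addr0 cy mulr1 mulr_natl cos2pi.
Qed.

Lemma expi_eq_sign x : expi x = 1 \/ expi x = -1 ->
  exists2 k, x = pi * k%:~R & expi x = (-1) ^+ `|k|%N.
Proof.
suff: expi x = 1 \/ expi x = -1 -> exists k, x = pi * k%:~R.
  by move=> P /P[k xk]; exists k; rewrite // xk expi_pi_int.
case=> [/expi_eq1[k ->]|ex].
  by exists (2 * k); rewrite intrM; ring.
have /expi_eq1[k xk] : expi (x - pi) = 1.
  by rewrite expiD ex expiN expi_pi rmorphN1 mulrNN mulr1.
by exists (2 * k + 1); rewrite intrD intrM; lra.
Qed.

End ExpI.

(** * The complex exponential series and matrix exponentials *)

Section ComplexExponential.
Local Open Scope classical_set_scope.
Variable R : realType.

Lemma cvg_complex (u v : R^nat) (a b : R) :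
  u @ \oo --> a -> v @ \oo --> b ->
  (fun n => u n +i* v n : (R[i] : numFieldType)) @ \oo -->
    (a +i* b : (R[i] : numFieldType)).
Proof.
move=> /cvgrPdist_lt ua /cvgrPdist_lt vb; apply/cvgrPdist_lt => e e0.
(* A positive element of [R[i]] is real, so half its real part serves as the tolerance for each
   coordinate. *)
have [e' e'0 ->] : exists2 e' : R, 0 < e' & e = e'%:C + e'%:C.
  move: e0; rewrite ltcE /= => /andP[/eqP e0 e1]; exists (complex.Re e / 2).
    by rewrite divr_gt0.
  by case: e e0 {e1} => x y /= ->; simpc; rewrite -splitr.
near=> n.
have -> : a +i* b - (u n +i* v n) = (a - u n)%:C + 'i%C * (b - v n)%:C.
  by simpc.
apply: le_lt_trans (ler_normD _ _) _; rewrite normrM.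
have -> : `|'i%C : R[i]| = 1 by rewrite normc_def /= expr0n expr1n add0r sqrtr1.
rewrite mul1r !normc_def /= !expr0n !addr0 !sqrtr_sqr ltrD // ltcR.
  by near: n; exact: ua.
by near: n; exact: vb.
Unshelve. all: by end_near. Qed.

Lemma cvg_expi (x : R) :
  series (fun k => (k`!%:R)^-1 * (0 +i* x) ^+ k : (R[i] : numFieldType)) @ \oo
    --> (expi x : (R[i] : numFieldType)).
Proof.
have -> : series (fun k => (k`!%:R)^-1 * (0 +i* x) ^+ k : (R[i] : numFieldType))
    = fun n => series (cos_coeff x) n +i* series (sin_coeff x) n.
  apply/funext => n; rewrite /series /=.
  elim: n => [|n IHn]; first by rewrite !big_geq.
  rewrite !big_nat_recr //= {}IHn /cos_coeff /sin_coeff /=.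
  set c1 := \sum_(_ <= _ < _) _; set c2 := \sum_(_ <= _ < _) _.
  (* Even powers of [ix] are real and odd ones imaginary, which matches the cosine and sine
     coefficients. The truncated [n.-1./2] matters only for odd [n], where it equals [n./2]. *)
  have -> : (0 +i* x) ^+ n = ((~~ odd n)%:R * (-1) ^+ n./2 * x ^+ n)
      +i* ((odd n)%:R * (-1) ^+ n.-1./2 * x ^+ n).
    have -> : 0 +i* x = 'i%C * x%:C by simpc.
    rewrite exprMn -rmorphXn /= -{1}[n]odd_double_half exprD -mul2n exprM sqr_i.
    have -> : (-1) ^+ n./2 = ((-1) ^+ n./2)%:C :> R[i] by rewrite rmorphXn rmorphN1.
    have [on|/negPf on] := boolP (odd n); rewrite /= ?mul0r ?mul1r; last by simpc.
    have -> : n.-1./2 = n./2 by rewrite -[in n.-1](odd_double_half n) on add1n doubleK.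
    by simpc.
  have -> : n`!%:R^-1 = (n`!%:R^-1)%:C :> R[i] by rewrite fmorphV rmorph_nat.
  by simpc; congr (_ +i* _); congr (_ + _); rewrite mulrC.
by apply: cvg_complex; rewrite unlock; [exact: is_cvg_series_cos_coeff
  | exact: is_cvg_series_sin_coeff].
Qed.

(** The partial sums of the matrix series are finite combinations of the [P x] whose coefficients
    are partial sums of scalar exponential series, so the limit is taken coefficientwise. *)
Lemma expmx_spectral (I : finType) (n : nat) (M : 'M[R[i]]_n) (theta : I -> R)
    (P : I -> 'M[R[i]]_n) :
  (forall k, M ^+ k = \sum_x (0 +i* theta x) ^+ k *: P x) ->
  expmx M = \sum_x expi (theta x) *: P x.
Proof.
move=> Mk; apply: cvg_lim; first exact: norm_hausdorff.
have -> : series (fun k : nat => (k`!%:R)^-1 *: M ^+ k) = fun N => \sum_x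
    series (fun k => (k`!%:R)^-1 * (0 +i* theta x) ^+ k) N *: P x.
  apply/funext => N; rewrite /series /=.
  under eq_bigr do rewrite Mk scaler_sumr.
  rewrite exchange_big; apply: eq_bigr => x _; rewrite scaler_suml.
  by apply: eq_bigr => k _; rewrite scalerA.
apply: cvg_big => [|x _]; first exact: add_continuous.
by apply: cvgZr_tmp; exact: cvg_expi.
Qed.

End ComplexExponential.

(** * Characters of [G]: separation and orthogonality *)

Section Characters.
Variables (R : realType) (G : finZmodType) (D : cyclic_decomposition G).
Implicit Types x y g h : G.
Local Notation chi := (chi R D).

(** This is the carry in modular addition; in [chiDr] it only adds whole turns to the angle. *)
Lemma natr_Zp_add n (i j : 'I_n.+1) :
  exists k : nat, (i : nat)%:R + (j : nat)%:R
    = (nat_of_ord (i + j))%:R + (k * n.+1)%N%:R :> R.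
Proof.
exists ((i + j)%N %/ n.+1)%N; rewrite -!natrD; congr (_%:R).
by rewrite [nat_of_ord (i + j)](_ : _ = (i + j)%N %% n.+1)%N // [RHS]addnC -divn_eq.
Qed.

Lemma chiC x g : chi x g = chi g x.
Proof. by apply: eq_bigr => s _; congr expi; ring. Qed.

Lemma chiDr x g h : chi x (g + h) = chi x g * chi x h.
Proof.
rewrite -big_split; apply: eq_bigr => s _ /=; rewrite -expiD raddfD /=.
have [k Hk] := natr_Zp_add (dec_coord s g) (dec_coord s h).
set X := 2 * pi * _; set n := (dec_m s).+1 in Hk *.
rewrite -[X * _ / _ + _]mulrDl -mulrDr Hk natrM mulrDr mulrDl expiD.
rewrite !mulrA mulfK ?pnatr_eq0 // /X -[_ * _ * k%:R]mulrA -natrM.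
by rewrite (pmulrn _ (_ * k)%N) expi_2pi_int mulr1.
Qed.

Lemma chiDl x y g : chi (x + y) g = chi x g * chi y g.
Proof. by rewrite chiC chiDr !(chiC g). Qed.

Lemma norm_chi x g : `|chi x g| = 1.
Proof. by rewrite normr_prod big1 // => s _; exact: norm_expi. Qed.

Lemma chi_neq0 x g : chi x g != 0.
Proof. by rewrite -normr_eq0 norm_chi oner_eq0. Qed.

Lemma chi0r x : chi x 0 = 1.
Proof. by apply: (mulfI (chi_neq0 x 0)); rewrite -chiDr addr0 mulr1. Qed.

Lemma chi0l g : chi 0 g = 1.
Proof. by rewrite chiC chi0r. Qed.

Lemma chi_conj x g : (chi x g)^* = chi x (- g).
Proof.
apply: (mulfI (chi_neq0 x g)); rewrite -chiDr subrr chi0r.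
by rewrite -sqr_normc norm_chi expr1n.
Qed.

Lemma chiNl x g : chi (- x) g = chi x (- g).
Proof. by rewrite chiC -chi_conj chiC chi_conj. Qed.

(** Some coordinate [g_s] is nonzero. The element whose only nonzero coordinate is a 1 in place [s]
    gives the character value [exp(2 pi i g_s / n_s)], which differs from 1 because
    [0 < g_s < n_s]. *)
Lemma chi_separates g : g != 0 -> exists x, chi x g != 1.
Proof.
move=> g0; have : exists s : 'I_(dec_r D), dec_coord s g != 0.
  have [/existsP //|] := boolP [exists s : 'I_(dec_r D), dec_coord s g != 0].
  rewrite negb_exists => /forallP all0; case/eqP: g0.
  have /bij_inj inj := dec_bij D.
  apply: inj; apply/ffunP => s; rewrite !ffunE raddf0.
  by apply/eqP; have := all0 s; rewrite negbK.
(* A nonzero coordinate forces [n_s] to be at least 2, so that [inord 1] really has value 1. *)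
case=> s gs; have m0 : (0 < dec_m s)%N.
  move: gs; case: (dec_coord s g) => i im; rewrite -val_eqE /= -lt0n => i0.
  exact: leq_trans i0 im.
case: (dec_bij D) => inv _ invK.
pose e : {dffun forall s, 'I_(dec_m s).+1} :=
  [ffun s' => if s' == s then inord 1 else 0].
have coordE s' : dec_coord s' (inv e) = if s' == s then inord 1 else 0.
  by have /ffunP/(_ s') := invK e; rewrite !ffunE.
exists (inv e); rewrite /Defs.chi (bigD1 s) //= big1 ?mulr1; last first.
  by move=> s' /negPf s's; rewrite coordE s's /= mulr0 !mul0r expi0.
rewrite coordE eqxx inordK // mulr1; apply/eqP => /expi_eq1[k].
have pi2 : 2 * pi != 0 :> R by rewrite mulf_neq0 ?gt_eqF ?pi_gt0.
move=> gk; have {gk} : (dec_coord s g)%:R = k%:~R * (dec_m s).+1%:R :> R.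
  by apply: (mulfI pi2); rewrite mulrA -gk divfK ?pnatr_eq0.
rewrite !pmulrn -intrM => /intr_inj gk.
have g1 : (0 < dec_coord s g < (dec_m s).+1)%N by rewrite ltn_ord andbT lt0n.
have not_multiple (a m : nat) : a%:Z = k * m%:Z -> ~ (0 < a < m)%N.
  by move=> am ltam; have [k0|k0] := leP k 0; nia.
exact: not_multiple gk g1.
Qed.

(** Translating the summation index by [y] multiplies the sum by [chi y g]; if this factor is not 1,
    the sum vanishes. *)
Lemma sum_chi_l g : \sum_x chi x g = (#|G| * (g == 0%R))%:R.
Proof.
have [->|/chi_separates[y yg]] := eqVneq g 0.
  by rewrite muln1 -sum1_card natr_sum; apply: eq_bigr => x _; rewrite chi0r.
rewrite muln0; apply/eqP; have : (chi y g - 1) * (\sum_x chi x g) = 0.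
  rewrite mulrBl mul1r mulr_sumr; apply/eqP; rewrite subr_eq0; apply/eqP.
  rewrite [RHS](reindex_inj (addrI y)) /=.
  by apply: eq_bigr => x _; rewrite chiDl.
by move/eqP; rewrite mulf_eq0 subr_eq0 (negPf yg).
Qed.

Lemma sum_chi_r x : \sum_g chi x g = (#|G| * (x == 0%R))%:R.
Proof. by rewrite -sum_chi_l; apply: eq_bigr => g _; rewrite chiC. Qed.

End Characters.

(** * Spectral decomposition of the Cayley graph and its transition matrix *)

Section Spectrum.
Variables (R : realType) (G : finZmodType) (D : cyclic_decomposition G).
Variable S : {set G}.
Hypothesis simpleS : cayley_simple S.
Implicit Types x y g h u v : G.
Local Notation chi := (chi R D).
Local Notation alpha := (alpha R D S).
Local Notation alphaR x := (complex.Re (alpha x)).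

Lemma card_neq0 : #|G|%:R != 0 :> R[i].
Proof. by rewrite pnatr_eq0 -lt0n; apply/card_gt0P; exists 0. Qed.

Lemma memNS g : (- g \in S) = (g \in S).
Proof.
have /setP/(_ (- g)) <- := simpleS.2; apply/imsetP/idP => [[s sS /oppr_inj ->]|gS] //.
by exists g.
Qed.

(** Conjugation replaces [s] by [-s], which permutes [S]. *)
Lemma alpha_real x : alpha x = (alphaR x)%:C.
Proof.
suff aJ : (alpha x)^* = alpha x.
  case: (alpha x) aJ => a b [] /eqP.
  by rewrite eq_sym -addr_eq0 -mulr2n mulrn_eq0 /= => /eqP ->.
rewrite rmorph_sum /= [RHS](reindex_inj oppr_inj) /=.
by apply: eq_big => g; rewrite ?memNS // => _; rewrite chi_conj.
Qed.

Lemma alpha0 : alpha 0 = #|S|%:R.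
Proof.
by rewrite -sum1_card natr_sum; apply: eq_bigr => s _; rewrite chi0l.
Qed.

(** After exchanging the sums, orthogonality leaves only the contribution of [s = 0], and [0] is not
    in [S]. *)
Lemma sum_alpha : \sum_x alpha x = 0.
Proof.
rewrite exchange_big big1 // => s sS; rewrite sum_chi_l.
have [s0|] := eqVneq s 0; last by rewrite muln0.
by move: simpleS.1; rewrite -s0 sS.
Qed.

(** This is the projector onto the line spanned by the character [chi x]. The projectors are
    orthogonal idempotents with sum 1. *)
Definition spectral_proj x : 'M[R[i]]_#|G| :=
  \matrix_(i, j) ((#|G|%:R)^-1 * chi x (enum_val i - enum_val j)).

Lemma spectral_projM x y :
  spectral_proj x *m spectral_proj y = (x == y)%:R *: spectral_proj x.
Proof.
apply/matrixP => i j; rewrite !mxE.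
transitivity ((#|G|%:R)^-1 ^+ 2 * (chi x (enum_val i) * chi y (- enum_val j))
    * \sum_v chi (y - x) v).
  rewrite mulr_sumr [RHS](reindex (@enum_val G predT)) /=; last first.
    by apply: onW_bij; exact: enum_val_bij.
  apply: eq_bigr => k _; rewrite !mxE !chiDr chiDl chiNl.
  by ring.
rewrite sum_chi_r subr_eq0 eq_sym; have [->|_] := eqVneq x y; last first.
  by rewrite muln0 mulr0 mul0r.
by rewrite muln1 mul1r chiDr; field; rewrite card_neq0.
Qed.

Lemma sum_spectral_proj : \sum_x spectral_proj x = 1%:M.
Proof.
apply/matrixP => i j; rewrite summxE.
under eq_bigr do rewrite mxE.
rewrite -mulr_sumr sum_chi_l subr_eq0 (inj_eq enum_val_inj) mxE natrM mulrA.
by rewrite mulVf ?card_neq0 // mul1r.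
Qed.

(** Expanding [alpha] turns the entry at [w = u - v] into a sum over [s] in [S] of orthogonality
    relations, which counts the [s] equal to [-w]; symmetry of [S] converts this into [w \in S]. *)
Lemma adjmx_spectral : adjmx R[i] (cayley S) = \sum_x alpha x *: spectral_proj x.
Proof.
apply/matrixP => i j; rewrite summxE !mxE.
set w := enum_val i - enum_val j; rewrite /cayley -/w.
transitivity (\sum_(s in S) (#|G|%:R)^-1 * \sum_x chi x (s + w)); last first.
  under eq_bigr do rewrite mulr_sumr.
  rewrite exchange_big; apply: eq_bigr => x _ /=; rewrite !mxE -/w mulr_suml.
  by apply: eq_bigr => s _; rewrite chiDr; ring.
under eq_bigr do rewrite sum_chi_l natrM mulrA mulVf ?card_neq0 // mul1r addr_eq0.
rewrite -natr_sum -memNS; congr (_%:R).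
have [wS|wS] := boolP (- w \in S).
  rewrite (bigD1 (- w)) //= eqxx big1 // => s /andP[_ /negPf].
  by rewrite -subr_eq0 opprK addr_eq0 => ->.
by rewrite big1 // => s sS; case: eqVneq wS => // <-; rewrite sS.
Qed.

Lemma spectral_sum_exp (f : G -> R[i]) k :
  (\sum_x f x *: spectral_proj x) ^+ k = \sum_x f x ^+ k *: spectral_proj x.
Proof.
elim: k => [|k IHk].
  by rewrite expr0; under eq_bigr do rewrite scale1r; rewrite sum_spectral_proj.
rewrite exprS {}IHk -[_ * _]/(_ *m _) mulmx_suml; apply: eq_bigr => x _.
rewrite mulmx_sumr (bigD1 x) //= big1 ?addr0 => [|y yx].
  by rewrite -scalemxAl -scalemxAr spectral_projM eqxx scale1r scalerA exprS.
by rewrite -scalemxAl -scalemxAr spectral_projM eq_sym (negPf yx) scale0r !scaler0.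
Qed.

Lemma transitionE (t : R) u v : transition (cayley S) t u v =
  (#|G|%:R)^-1 * \sum_x expi (t * alphaR x) * chi x (u - v).
Proof.
rewrite /transition (@expmx_spectral _ _ _ _ (fun x => t * alphaR x) spectral_proj).
  rewrite summxE mulr_sumr; apply: eq_bigr => x _.
  by rewrite !mxE !enum_rankK mulrCA.
move=> k; rewrite adjmx_spectral scaler_sumr.
under eq_bigr do rewrite scalerA.
rewrite spectral_sum_exp; apply: eq_bigr => x _; congr (_ ^+ k *: _).
by rewrite [in LHS]alpha_real; simpc.
Qed.

(* All [#|G|] terms of [transitionE] have modulus 1, so the average has modulus 1
   only if they all agree with the term at [x = 0]. *)
Lemma pstP (t : R) u v : pst (cayley S) u v t <->
  0 < t /\ forall x, expi (t * (#|S|%:R - alphaR x)) = chi x (u - v).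
Proof.
rewrite /pst transitionE; set F := fun x => expi (t * alphaR x) * chi x (u - v).
have normF x : `|F x| = 1 by rewrite normrM norm_expi norm_chi mulr1.
have F0 : F 0 = expi (t * #|S|%:R).
  by rewrite /F alpha0 chi0l mulr1 -(rmorph_nat (real_complex R)).
have sum1 : \sum_(x : G) `|F x| = #|G|%:R.
  by under eq_bigr do rewrite normF; rewrite sumr_const.
have FE x : F x = F 0 <-> expi (t * (#|S|%:R - alphaR x)) = chi x (u - v).
  rewrite F0 mulrBr expiD expiN conj_expi /F; split => [<-|<-].
    by rewrite mulrAC mulfV ?mul1r ?expi_neq0.
  by rewrite mulrCA mulfV ?mulr1 ?expi_neq0.
split=> [[t0 normH]|[t0 Fx]]; split=> //.
  move: normH.
  rewrite normrM normfV normr_nat => /(canRL (mulVKf card_neq0)).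
  rewrite mulr1 -sum1 => sumF x.
  have [c _ Fc] := normC_sum_eq1 sumF (fun x _ => normF x).
  by apply: (FE x).1; exact: etrans (Fc x isT) (esym (Fc 0 isT)).
rewrite (eq_bigr (fun=> F 0)) => [|x _]; last exact: (FE x).2.
rewrite sumr_const -(mulr_natl (F 0)) mulrA mulVf ?card_neq0 // mul1r; exact: normF.
Qed.

End Spectrum.

(** * Integrality, 2-adic valuations and gcds *)

Section Arithmetic.

Lemma eq1N1 (K : numDomainType) : (1 == -1 :> K) = false.
Proof. by rewrite -addr_eq0 -mulr2n pnatr_eq0. Qed.

(** Viewed in [algC], the root is an algebraic integer, and a rational algebraic integer is an
    integer. *)
Lemma rat_root_monic_int (p : {poly int}) (q : rat) :
  p \is monic -> root (map_poly intr p) q -> q \in Num.int.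
Proof.
move=> p1 rq; have : (ratr q : algC) \in Num.int.
  apply: Cint_rat_Aint; first exact: Crat_rat.
  apply: (root_monic_Aint (p := map_poly intr p)); last 2 first.
  - exact: monic_map.
  - by apply/polyOverP => i; rewrite coef_map intr_int.
  by rewrite -(fmorph_root (@ratr algC)) -map_poly_comp (eq_map_poly (ratr_int _)) in rq.
case/intrP => k /esym /eqP.
by rewrite -(ratr_int algC) (inj_eq (fmorph_inj _)) => /eqP <-; rewrite intr_int.
Qed.

Lemma v2_int (z : int) :
  v2 z%:Q = if z == 0 then +oo%E else (logn 2 `|z|%N)%:Z%:E.
Proof.
by rewrite /v2 numq_int denq_int intr_eq0 absz1 logn1 subr0.
Qed.

(** Valuation bounds become divisibility, uniformly in [z]: zero has infinite valuation and is
    divisible by every power of 2. *)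
Lemma le_v2_int (r : nat) (z : int) :
  ((r%:Z)%:E <= v2 z%:Q)%E = (2 ^ r %| `|z|)%N.
Proof.
rewrite v2_int; have [->|z0] := eqVneq z 0; first by rewrite leey absz0 dvdn0.
by rewrite lee_fin lez_nat pfactor_dvdn // absz_gt0.
Qed.

Lemma dvdz_biggcd (I : finType) (A : {set I}) (F : I -> int) (d : int) :
  (d %| \big[gcdz/0]_(i in A) F i)%Z <-> (forall i, i \in A -> (d %| F i)%Z).
Proof.
rewrite (big_morph (fun z => d %| z)%Z (id1 := true) (op1 := andb)) ?dvdz0 //.
  rewrite big_andE; split => [/forall_inP//|dF]; exact/forall_inP.
by move=> m n; rewrite dvdz_gcd.
Qed.

Lemma biggcdz_ge0 (I : finType) (A : {set I}) (F : I -> int) :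
  0 <= \big[gcdz/0]_(i in A) F i.
Proof. exact: (big_rec (fun z : int => 0 <= z)). Qed.

(* The integers [z] with [t * z \in pi * Z] form an ideal. *)
Lemma biggcdz_mul_pi (R : realType) (t : R) (I : finType) (A : {set I})
    (F : I -> int) :
  (forall i, i \in A -> exists k : int, t * (F i)%:~R = pi * k%:~R) ->
  exists k : int, t * (\big[gcdz/0]_(i in A) F i)%:~R = pi * k%:~R.
Proof.
move=> tF; apply: (big_ind (fun z => exists k : int, t * z%:~R = pi * k%:~R)) => //.
  by exists 0; rewrite !mulr0.
move=> m n [k mk] [l nl]; have [u [v <-]] := Bezoutz m n.
exists (u * k + v * l); rewrite !intrD !intrM mulrDr !(mulrCA t) mk nl; ring.
Qed.

(** Positivity matters: [logn 2 0] is 0 by convention, while 0 is even. *)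
Lemma logn2_eq0 (n : nat) : (0 < n)%N -> (logn 2 n == 0)%N = odd n.
Proof.
by move=> n0; rewrite -leqn0 leqNgt -[(0 < _)%N]pfactor_dvdn // expn1 dvdn2 negbK.
Qed.

End Arithmetic.

(** * Necessity of order two and of integrality *)

Section PST.
Variables (R : realType) (G : finZmodType) (D : cyclic_decomposition G).
Variable S : {set G}.
Hypotheses (simpleS : cayley_simple S) (S_neq0 : S != finset.set0).
Implicit Types x y g h u v a : G.
Local Notation chi := (chi R D).
Local Notation alpha := (alpha R D S).
Local Notation alphaR x := (complex.Re (alpha x)).
Local Notation dmalpha := (dmalpha R D S).
Local Notation Mall := (Mall R D S).

Lemma order_eq2 a : a != 0 -> #[a]%g = 2%N <-> a + a = 0.
Proof.
move=> a0; split => [a2|aa0]; first by have := expg_order a; rewrite a2.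
have : (#[a]%g %| 2)%N by rewrite order_dvdn; apply/eqP.
by rewrite dvdn_divisors // !inE order_eq1 (negPf a0) => /eqP.
Qed.

Lemma chi_sign a x : a + a = 0 -> chi x a = 1 \/ chi x a = -1.
Proof.
move=> aa0; have /eqP : chi x a ^+ 2 = 1 by rewrite expr2 -chiDr aa0 chi0r.
by rewrite sqrf_eq1 => /orP[] /eqP; [left|right].
Qed.

Lemma alphaN x : alpha (- x) = alpha x.
Proof.
rewrite /Defs.alpha [RHS](reindex_inj oppr_inj) /=.
by apply: eq_big => g; rewrite ?(memNS simpleS) // => _; rewrite chiNl.
Qed.

(** The phase condition and [alphaN] give [chi (- x) a = chi x a], hence [chi x (a + a) = 1] for
    every [x], and characters separate points. *)
Lemma pst_order2 (t : R) g h : pst (cayley S) g h t -> (g - h) + (g - h) = 0.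
Proof.
set a := g - h; case/(pstP D simpleS) => _ tchi.
apply/eqP; apply: contraT => /(chi_separates R D)[x]; rewrite chiDr.
have xa : chi (- x) a = chi x a by rewrite -!tchi alphaN.
by rewrite -{1}xa -chiDl addNr chi0l eqxx.
Qed.

Lemma alpha_eigenvalue x : eigenvalue (adjmx R[i] (cayley S)) (alpha x).
Proof.
(* The eigenvector is the row of the projector at vertex [0], all of whose entries are nonzero. *)
apply/eigenvalueP; exists (row (enum_rank (0 : G)) (spectral_proj R D x)).
  rewrite -row_mul (adjmx_spectral R D simpleS) mulmx_sumr (bigD1 x) //= big1.
    by rewrite addr0 -scalemxAr spectral_projM eqxx scale1r linearZ.
  by move=> y yx; rewrite -scalemxAr spectral_projM eq_sym (negPf yx) scale0r scaler0.
apply/eqP => /rowP/(_ (enum_rank 0)); rewrite !mxE => /eqP.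
by rewrite mulf_eq0 invr_eq0 (negPf (card_neq0 _ _)) (negPf (chi_neq0 _ _ _ _)).
Qed.

Lemma rat_alpha_int x (q : rat) : alpha x = ratr q -> exists k : int, alpha x = k%:~R.
Proof.
move=> xq; pose A : 'M[int]_#|G| := \matrix_(i, j) (cayley S (enum_val i) (enum_val j))%:R.
suff /intrP[k qk] : q \in Num.int by exists k; rewrite xq qk ratr_int.
apply: (rat_root_monic_int (char_poly_monic A)).
rewrite -(fmorph_root (@ratr R[i])) -map_poly_comp (eq_map_poly (ratr_int _)).
rewrite map_char_poly; have := alpha_eigenvalue x; rewrite xq eigenvalue_root_char.
congr (root (char_poly _) _); apply/matrixP => i j.
by rewrite !mxE rmorph_nat.
Qed.

Lemma pst_integral (t : R) g h : pst (cayley S) g h t -> integral_cayley R D S.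
Proof.
move=> pst_t; have aa0 := pst_order2 pst_t; set a := g - h in aa0.
have [t0 tchi] := (pstP D simpleS t g h).1 pst_t.
have /choice[k tk] x : exists k : int, t * (#|S|%:R - alphaR x) = pi * k%:~R.
  have [|k ? _] := @expi_eq_sign R (t * (#|S|%:R - alphaR x)).
    by rewrite tchi; exact: chi_sign.
  by exists k.
have dn0 : #|S|%:R * #|G|%:R != 0 :> R.
  rewrite -natrM pnatr_eq0 muln_eq0 cards_eq0 negb_or S_neq0 -lt0n.
  by apply/card_gt0P; exists 0.
(* Summing the phase equations over all [x] eliminates the eigenvalues, since they sum to 0, and
   expresses [t] through [pi] and integers. *)
have tK : t * (#|S|%:R * #|G|%:R) = pi * (\sum_x k x)%:~R.
  rewrite rmorph_sum mulr_sumr /=; under [RHS]eq_bigr do rewrite -tk.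
  rewrite -mulr_sumr sumrB sumr_const -(mulr_natr #|S|%:R).
  have -> : \sum_x alphaR x = 0.
    apply: (@complexI R); rewrite rmorph_sum /= -[RHS](sum_alpha R D simpleS).
    by apply: eq_bigr => x _; rewrite -(alpha_real R D simpleS).
  by rewrite subr0.
set K := \sum_x k x in tK; set N := (_ * _) in dn0 tK.
have pi0 : pi != 0 :> R by rewrite gt_eqF ?pi_gt0.
have K0 : K%:~R != 0 :> R.
  apply: contra_neq (lt0r_neq0 t0) => K0; apply: (mulIf dn0).
  by rewrite tK K0 mulr0 mul0r.
(* The rational witness comes from dividing [t (d - alpha_x) = pi k_x] by [t d n = pi K]. *)
move=> x; apply: (@rat_alpha_int x (#|S|%:Q - (k x)%:Q * (#|S| * #|G|)%N%:Q / K%:Q)).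
rewrite (alpha_real R D simpleS) rmorphB /= fmorph_div rmorphM /= !ratr_int.
have -> : alphaR x = #|S|%:R - (k x)%:~R * (#|S| * #|G|)%N%:R / K%:~R.
  suff -> : (k x)%:~R * (#|S| * #|G|)%N%:R / K%:~R = #|S|%:R - alphaR x by rewrite subKr.
  rewrite natrM -/N; apply: (canLR (mulfK K0)).
  apply: (mulfI (mulf_neq0 (lt0r_neq0 t0) pi0)).
  transitivity (pi * (k x)%:~R * (t * N)); first by ring.
  by rewrite tK -tk; ring.
by rewrite rmorphB fmorph_div rmorphM /= !rmorph_nat !rmorph_int.
Qed.

(** Under integrality the floor in [alphaZ] loses nothing. *)
Lemma dmalphaE x : integral_cayley R D S -> #|S|%:R - alphaR x = (dmalpha x)%:~R.
Proof.
move=> intS; rewrite /Defs.dmalpha /alphaZ; have [k ->] := intS x.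
by rewrite -(rmorph_int (real_complex R)) /= intrKfloor intrB.
Qed.

Lemma dmalpha0 : dmalpha 0 = 0.
Proof.
rewrite /Defs.dmalpha /alphaZ alpha0 -(rmorph_nat (real_complex R)) /=.
by rewrite pmulrn intrKfloor subrr.
Qed.

(** * The valuation condition and the set of transfer times *)

Section Pair.
Variables g h : G.
Let a := g - h.
Hypotheses (intS : integral_cayley R D S) (a_neq0 : a != 0) (aa0 : a + a = 0).

Lemma pst_parityP (t : R) : pst (cayley S) g h t <->
  0 < t /\ forall x, exists2 k : int,
    t * (dmalpha x)%:~R = pi * k%:~R & odd `|k| = (chi x a == -1).
Proof.
have signE (k : int) x : (-1) ^+ `|k|%N = chi x a <-> odd `|k| = (chi x a == -1).
  rewrite -signr_odd; have [->|->] := chi_sign x aa0.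
    rewrite eq1N1; case: odd; rewrite ?expr1 ?expr0; split=> // /eqP.
    by rewrite eq_sym eq1N1.
  rewrite eqxx; case: odd; rewrite ?expr1 ?expr0; split=> // /eqP.
  by rewrite eq1N1.
rewrite (pstP D simpleS) -/a; split=> -[t0 tchi]; split=> // x.
  have [|k tk ek] := @expi_eq_sign R (t * (#|S|%:R - alphaR x)).
    by rewrite tchi; exact: chi_sign.
  by exists k; [rewrite -dmalphaE|apply/signE; rewrite -ek tchi].
have [k tk /signE <-] := tchi x.
by rewrite dmalphaE // tk expi_pi_int.
Qed.

Lemma G1_nonempty : exists x, chi x a = -1.
Proof.
have [x xa] := chi_separates R D a_neq0; exists x.
by have [xa1|//] := chi_sign x aa0; rewrite xa1 eqxx in xa.
Qed.

Lemma pst_valuation (t : R) : pst (cayley S) g h t -> valuation_condition R D S a.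
Proof.
case/pst_parityP => t0 tk; have [y ya] := G1_nonempty.
have [l tl] := tk y; rewrite ya eqxx => oddl.
have l0 : l != 0 by apply: contraTneq oddl => ->.
have pi0 : pi != 0 :> R by rewrite gt_eqF ?pi_gt0.
have Dy0 : dmalpha y != 0.
  apply: contra_neq l0 => Dy0; apply/eqP; move/eqP: tl.
  by rewrite Dy0 mulr0 eq_sym mulf_eq0 (negPf pi0) intr_eq0.
(* Comparing the phase equations at [x] and [y] eliminates both [t] and [pi]. *)
have cross x (k : int) : t * (dmalpha x)%:~R = pi * k%:~R ->
    (`|dmalpha x| * `|l| = `|dmalpha y| * `|k|)%N.
  move=> txk; rewrite -!abszM; congr absz; apply: (@intr_inj R).
  apply: (mulfI (mulf_neq0 (lt0r_neq0 t0) pi0)); rewrite !intrM.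
  transitivity (t * (dmalpha x)%:~R * (pi * l%:~R)); first by ring.
  by rewrite txk -tl; ring.
have logl : logn 2 `|l| = 0%N by apply/eqP; rewrite logn2_eq0 ?absz_gt0.
exists (logn 2 `|dmalpha y|)%:Z; split => [x|].
  rewrite inE chiC => /eqP xa; have [k txk] := tk x; rewrite xa eqxx => oddk.
  have k0 : k != 0 by apply: contraTneq oddk => ->.
  have logk : logn 2 `|k| = 0%N by apply/eqP; rewrite logn2_eq0 ?absz_gt0.
  have xy := cross x k txk.
  have Dx0 : dmalpha x != 0.
    rewrite -absz_eq0; apply: contra_eq_neq xy => ->.
    by rewrite mul0n eq_sym muln_eq0 !absz_eq0 negb_or Dy0.
  rewrite v2_int (negPf Dx0); congr (_%:Z%:E).
  have /(congr1 (logn 2)) := xy; rewrite !lognM ?absz_gt0 //.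
  by rewrite logl logk !addn0.
rewrite -[1]/(1%:Z) -PoszD le_v2_int.
suff : ((2 ^ (logn 2 `|dmalpha y| + 1))%N%:Z %| M0 R D S a)%Z by rewrite dvdzE.
apply/dvdz_biggcd => x; rewrite inE chiC => /eqP xa; rewrite dvdzE /=.
have [k txk] := tk x; rewrite xa eq1N1 => /negbT; rewrite -dvdn2 => evenk.
(* The odd factor [l] is coprime to powers of 2, so divisibility may be tested after multiplying by
   it. In the product [(d - alpha_y) k], the even [k] supplies the extra factor 2. *)
rewrite -(@Gauss_dvdl _ _ `|l|); last by rewrite coprimeXl ?coprime2n.
rewrite (cross x k txk) expnD expn1 dvdn_mul //.
exact: pfactor_dvdnn.
Qed.

(** The condition makes [M] have valuation exactly [rho], so dividing by [M] leaves an odd quotient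
    on [G1] and an even one on [G0]. *)
Lemma Mall_parity : valuation_condition R D S a ->
  0 < Mall /\ forall x, exists2 e : int,
    dmalpha x = Mall * e & odd `|e| = (chi x a == -1).
Proof.
case=> rho [val1 val0]; have [y ya] := G1_nonempty.
have inG1 x : chi x a = -1 -> x \in G1 R D a by move=> xa; rewrite inE chiC xa.
(* As [rho] is finite, [d - alpha_y] is nonzero and [rho] is the natural number [r]. *)
have := val1 y (inG1 y ya); rewrite v2_int; case: eqVneq => // Dy0 [rhoE].
set r := logn 2 `|dmalpha y| in rhoE; move: val0 val1; rewrite -{}rhoE => val0 val1.
have logn1 x : chi x a = -1 -> dmalpha x != 0 /\ logn 2 `|dmalpha x| = r.
  by move/inG1/val1; rewrite v2_int; case: eqVneq => // Dx0 [].
have dvd0 x : chi x a = 1 -> (2 ^ r.+1 %| `|dmalpha x|)%N.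
  move=> xa; move: val0; rewrite -[1]/(1%:Z) -PoszD addn1 le_v2_int => dM0.
  have /dvdz_biggcd/(_ x) : ((2 ^ r.+1)%N%:Z %| M0 R D S a)%Z by rewrite dvdzE.
  by rewrite inE chiC xa eqxx dvdzE; exact.
have dvdr x : (2 ^ r %| `|dmalpha x|)%N.
  have [/dvd0|/logn1[Dx0 <-]] := chi_sign x aa0.
    by apply: dvdn_trans; rewrite dvdn_exp2l.
  exact: pfactor_dvdnn.
have MD x : (Mall %| dmalpha x)%Z.
  have [->|x0] := eqVneq x 0; first by rewrite dmalpha0 dvdz0.
  by have /dvdz_biggcd/(_ x) := dvdzz Mall; rewrite inE x0; exact.
have M_neq0 : Mall != 0.
  by apply: contra_neq Dy0 => M0; have := MD y; rewrite M0 dvd0z => /eqP.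
(* The upper bound holds because [M] divides [d - alpha_y], the lower one because [2 ^ r] divides
   every term of the gcd. *)
have logM : logn 2 `|Mall| = r.
  apply/eqP; rewrite eqn_leq dvdn_leq_log ?absz_gt0 //=; last exact: MD.
  rewrite -pfactor_dvdn ?absz_gt0 //.
  suff : ((2 ^ r)%N%:Z %| Mall)%Z by rewrite dvdzE.
  by apply/dvdz_biggcd => x _; rewrite dvdzE dvdr.
split=> [|x]; first by rewrite lt_def M_neq0 biggcdz_ge0.
exists (dmalpha x %/ Mall)%Z; first by rewrite mulrC divzK.
set e := (_ %/ _)%Z; have DE : dmalpha x = Mall * e by rewrite mulrC divzK.
have loge : e != 0 -> logn 2 `|dmalpha x| = (r + logn 2 `|e|)%N.
  by move=> e0; rewrite DE abszM lognM ?absz_gt0 // logM.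
have [xa|xa] := chi_sign x aa0; rewrite xa.
  (* The quotient may be 0, as at [x = 0]; then it is even, as required. *)
  rewrite eq1N1; have [->//|e0] := eqVneq e 0; rewrite -logn2_eq0 ?absz_gt0 //.
  have := dvd0 x xa; rewrite pfactor_dvdn ?absz_gt0 ?DE ?mulf_neq0 //.
  by rewrite -DE loge // -addn1 leq_add2l lt0n => /negPf.
have [Dx0 logx] := logn1 x xa.
have e0 : e != 0 by apply: contra_neq Dx0 => e0; rewrite DE e0 mulr0.
by rewrite eqxx -logn2_eq0 ?absz_gt0 // -(eqn_add2l r) -loge // logx addn0 eqxx.
Qed.

Lemma pst_timesE : valuation_condition R D S a ->
  pst_times (cayley S) g h =
     [set t : R | exists l : nat,
        t = pi / Mall%:~R + 2 * pi / Mall%:~R * l%:R]%classic.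
Proof.
move=> /Mall_parity[M0 Me]; have MR0 : 0 < Mall%:~R :> R by rewrite ltr0z.
have timeE (l : nat) : pi / Mall%:~R + 2 * pi / Mall%:~R * l%:R
    = pi * (1 + 2 * l)%N%:R / Mall%:~R :> R.
  by rewrite natrD natrM; ring.
apply/seteqP; split => t /=.
  (* By Bezout, [t M = pi K] for an integer [K]. *)
  case/pst_parityP => t0 tk; have [|K tK] := @biggcdz_mul_pi R t _ [set x | x != 0] dmalpha.
    by move=> x _; have [k tx _] := tk x; exists k.
  have [y ya] := G1_nonempty; have [e De] := Me y; rewrite ya eqxx => odde.
  have [k tyk] := tk y; rewrite ya eqxx => oddk.
  (* At a point [y] of [G1] the multiplier [k] is odd and factors through [K], which makes [K]
     odd. *)
  have kE : k = K * e.
    apply: (@intr_inj R); apply: (mulfI (lt0r_neq0 (pi_gt0 R))).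
    by rewrite -tyk De !intrM !mulrA -tK.
  have oddK : odd `|K| by move: oddk; rewrite kE abszM oddM => /andP[].
  have K0 : 0 < K.
    by rewrite -(ltr0z R) -(pmulr_rgt0 _ (pi_gt0 R)) -tK mulr_gt0.
  (* For odd positive [K], rounding [K / 2] down gives the [l] with [K = 1 + 2 l]. *)
  exists `|K|./2; rewrite timeE.
  have -> : (1 + 2 * `|K|./2 = `|K|)%N by rewrite -[RHS]odd_double_half oddK mul2n.
  by rewrite pmulrn gtz0_abs // -tK mulfK // gt_eqF.
case=> l ->; rewrite timeE; apply/pst_parityP; split=> [|x].
  by rewrite divr_gt0 ?mulr_gt0 ?pi_gt0 // ltr0n.
(* Multiplying by the odd number [1 + 2 l] preserves the parity of [e]. *)
have [e -> odde] := Me x; exists ((1 + 2 * l)%N%:Z * e).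
  by rewrite !intrM mulrA divfK ?gt_eqF // mulrA.
by rewrite abszM oddM absz_nat oddD oddM /= odde.
Qed.

Lemma pst_exists : valuation_condition R D S a -> exists t : R, pst (cayley S) g h t.
Proof.
move=> val; exists (pi / Mall%:~R).
suff : pst_times (R := R) (cayley S) g h (pi / Mall%:~R) by [].
by rewrite pst_timesE //; exists 0%N; rewrite mulr0 addr0.
Qed.

End Pair.

End PST.

(** * From connectedness to a nonzero degree, and the final equivalence *)

Lemma cayley_connected_neq0 (G : finZmodType) (S : {set G}) :
  (1 < #|G|)%N -> cayley_connected S -> S != finset.set0.
Proof.
move=> G1 conn; apply: contraTneq G1 => S0.
by rewrite -leqNgt -cardsT -conn S0 gen0 cards1.
Qed.

Local Close Scope complex_scope.

Theorem theorem2p4 (R : realType) (G : finZmodType)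
    (D : cyclic_decomposition G) (S : {set G}) (g h : G)
    (hn : (3 <= #|G|)%N) (hsimple : cayley_simple S)
    (hconn : cayley_connected S) (ha : g - h != 0) :
  ((exists t : R, pst (cayley S) g h t) <->
     [/\ integral_cayley R D S,
         #[g - h]%g = 2%N
       & valuation_condition R D S (g - h)]) /\
  ([/\ integral_cayley R D S,
       #[g - h]%g = 2%N
     & valuation_condition R D S (g - h)] ->
   pst_times (cayley S) g h =
     [set t : R | exists l : nat,
        t = pi / (Mall R D S)%:~R + 2 * pi / (Mall R D S)%:~R * l%:R]%classic).
Proof.
have S_neq0 := cayley_connected_neq0 (ltnW hn) hconn.
have o2 := order_eq2 ha.
split; last by case=> intS /o2 aa0; exact: pst_timesE.
split => [[t pst_t]|[intS /o2 aa0]]; last exact: pst_exists.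
have aa0 := pst_order2 D hsimple pst_t.
have intS := pst_integral D hsimple S_neq0 pst_t.
by split; [|exact/o2|exact: pst_valuation pst_t].
Qed.
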